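(* Let $\Omega\subset\mathbb{R}^n$ be a bounded open set, $s\in(0,1)$ and $p,q\in[1,\infty)$. Then for every $\xi\in\mathbb{S}^{n-1}$ and every $f\in C^1(\mathbb{R}^n)$ with support in $\Omega$, $$\|f\|_{L^p}\le C(1-s)^{\frac1q}\,\mathrm{w}(\Omega,\xi)^s\Big(\int_0^{\mathrm{w}(\Omega,\xi)}t^{-sq}\|\Delta_{t\xi}f\|^q_{L^p}\frac{dt}{t}\Big)^{1/q},$$ where $$C=\frac{9}{c_p}\Big(\frac{q}{sq+1}\Big)^{1/q}\max\Big\{1,\frac{c_p}{3}\Big\}^{1-s},\qquad c_p=\begin{cases}\frac2p\,\frac{\pi-\pi/p}{\sin(\pi/p)}(p-1)^{\frac1p-1},&p>1,\\ 2,&p=1.\end{cases}$$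
   Context: $\Delta_hf(x)=f(x+h)-f(x)$. $\mathrm{w}(\Omega,\xi)=\sup_{x,y\in\Omega}(x-y)\cdot\xi$ is the width of $\Omega$ in the direction $\xi$. *)

(* Defs.v *)
From HB Require Import structures.
From mathcomp Require Import all_boot all_order all_algebra.
From mathcomp Require Import all_classical all_reals all_analysis.
Set Implicit Arguments. Unset Strict Implicit. Unset Printing Implicit Defensive.
Import Order.TTheory GRing.Theory Num.Theory.
Import numFieldNormedType.Exports.
Local Open Scope classical_set_scope.
Local Open Scope ring_scope.

Section Defs.
Context {R : realType}.

Definition evec (n : nat) (i : 'I_n) : 'rV[R]_n := \row_j (i == j)%:R.

Definition dotv (n : nat) (x y : 'rV[R]_n) : R := \sum_(i < n) x 0 i * y 0 i.

Definition unit_sphere (n : nat) : set 'rV[R]_n := [set xi | dotv xi xi = 1].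

Definition width (n : nat) (Omega : set 'rV[R]_n) (xi : 'rV[R]_n) : R :=
  sup [set dotv (x - y) xi | x in Omega & y in Omega].

Definition fdiff (n : nat) (h : 'rV[R]_n) (f : 'rV[R]_n -> R) : 'rV[R]_n -> R :=
  fun x => f (x + h) - f x.

Definition C1 (n : nat) (f : 'rV[R]_n -> R) : Prop :=
  (forall (x : 'rV[R]_n) (i : 'I_n), derivable f x (evec i)) /\
  (forall i : 'I_n, continuous (fun x => 'D_(evec i) f x)).

Definition support_in (n : nat) (f : 'rV[R]_n -> R) (Omega : set 'rV[R]_n) : Prop :=
  closure [set x | f x != 0] `<=` Omega.

(* Lebesgue integral of a non-negative function on R^n, computed as the
   iterated one-dimensional Lebesgue integral (Tonelli); R^0 is a point. *)
Fixpoint lebint_Rn (n : nat) : ('rV[R]_n -> \bar R) -> \bar R :=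
  match n return ('rV[R]_n -> \bar R) -> \bar R with
  | 0 => fun g => g 0
  | n'.+1 => fun g =>
      (\int[@lebesgue_measure R]_t
         lebint_Rn (fun y : 'rV[R]_n' => g (row_mx (const_mx t : 'rV[R]_1) y)))%E
  end.

Definition Lpnorm (n : nat) (p : R) (f : 'rV[R]_n -> R) : \bar R :=
  poweR (lebint_Rn (fun x => (`|f x| `^ p)%:E)) p^-1.

Definition c_const (p : R) : R :=
  if 1 < p then
    (2 / p) * ((pi - pi / p) / sin (pi / p)) * (p - 1) `^ (p^-1 - 1)
  else 2.

Definition C_const (s p q : R) : R :=
  (9 / c_const p) * (q / (s * q + 1)) `^ q^-1 * (Num.max 1 (c_const p / 3)) `^ (1 - s).

End Defs.

(* Main.v *)
Require Import Defs.
From HB Require Import structures.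
From mathcomp Require Import all_boot all_order all_algebra.
From mathcomp Require Import all_classical all_reals all_analysis.
From mathcomp Require Import measurable_realfun ring lra.
Import Order.TTheory GRing.Theory Num.Theory.
Import numFieldNormedType.Exports.
Local Open Scope classical_set_scope.
Local Open Scope ring_scope.

(** Let w be the width of Omega in the direction xi. If k t >= w, then f and its
    translate by k t xi have disjoint supports, so the p-th power of the L^p norm
    of their difference is twice that of f. Telescoping this difference into k
    translates of the difference with step t xi, the power-mean inequality and
    translation invariance bound it by k^p times the p-th power of the norm of a
    single difference. With k <= 2 w / t, the norm of the difference with step
    t xi is at least 2^(1/p - 1) (t / w) times the norm of f, and integrating this
    against t^(-sq-1) over (0, w] gives the inequality with the constant
    2^(1 - 1/p) q^(1/q). It is smaller than the stated one because
    (sq+1)^(1/q) <= 2 and c_p <= (9/4) 2^(1/p). *)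

(** * Iterated integrals of Lipschitz functions with bounded support *)

Section lebint.
Context {R : realType}.
Implicit Types (n : nat) (M L : R).
Local Notation mu := (@lebesgue_measure R).

(** Only increments along the axes are controlled: bounds on partial derivatives give this directly,
    and slicing preserves it with the same constant. *)
Definition coord_lipschitz {n} L (g : 'rV[R]_n -> R) :=
  forall (x : 'rV[R]_n) i h, `|g (x + h *: evec i) - g x| <= L * `|h|.

Definition box_supported {n} M (g : 'rV[R]_n -> R) :=
  forall (x : 'rV[R]_n) i, M < `|x 0 i| -> g x = 0.

(** The class of integrands used throughout; it is stable under slices, translations, differences
    and [p]-th powers of the modulus for [p >= 1]. In dimension 0 it contains every function. *)
Definition lipc {n} (g : 'rV[R]_n -> R) :=
  exists M L, [/\ 0 <= M, 0 <= L, coord_lipschitz L g & box_supported M g].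

Definition slice {n} (g : 'rV[R]_n.+1 -> R) (t : R) : 'rV[R]_n -> R :=
  fun y => g (row_mx (const_mx t : 'rV[R]_1) y).

Lemma row_mx_shift_head {n} (t h : R) (y : 'rV[R]_n) :
  row_mx (const_mx (t + h) : 'rV[R]_1) y =
  (row_mx (const_mx t : 'rV[R]_1) y : 'rV[R]_n.+1) + h *: evec ord0.
Proof.
apply/rowP => j; rewrite !mxE; case: splitP => k /= jk; rewrite ?mxE.
  have -> : j = ord0 by apply/val_inj; rewrite /= jk ord1.
  by rewrite eqxx mulr1.
have -> : (ord0 == j :> 'I_n.+1) = false.
  by apply/negbTE/eqP => /(congr1 val) /=; rewrite jk.
by rewrite mulr0 addr0.
Qed.

Lemma row_mx_shift_tail {n} (t h : R) (y : 'rV[R]_n) i :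
  row_mx (const_mx t : 'rV[R]_1) (y + h *: evec i) =
  (row_mx (const_mx t : 'rV[R]_1) y : 'rV[R]_n.+1)
    + h *: evec (rshift 1 i : 'I_n.+1).
Proof.
apply/rowP => j; rewrite !mxE; case: splitP => k /= jk; rewrite ?mxE.
  have -> : (rshift 1 i == j :> 'I_n.+1) = false.
    by apply/negbTE/eqP => /(congr1 val) /=; rewrite jk ord1.
  by rewrite mulr0 addr0.
have -> // : (rshift 1 i == j :> 'I_n.+1) = (i == k).
by rewrite -!val_eqE /= jk.
Qed.

Lemma row_mx_head {n} (t : R) (y : 'rV[R]_n) :
  (row_mx (const_mx t : 'rV[R]_1) y : 'rV[R]_n.+1) 0 ord0 = t.
Proof.
by rewrite mxE; case: splitP => k /= jk; rewrite ?mxE.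
Qed.

Lemma row_mx_tail {n} (t : R) (y : 'rV[R]_n) i :
  (row_mx (const_mx t : 'rV[R]_1) y : 'rV[R]_n.+1) 0 (rshift 1 i : 'I_n.+1)
  = y 0 i.
Proof. exact: row_mxEr. Qed.

Lemma coord_lipschitz_slice {n} L (g : 'rV[R]_n.+1 -> R) t :
  coord_lipschitz L g -> coord_lipschitz L (slice g t).
Proof. by move=> Lg x i h; rewrite /slice row_mx_shift_tail. Qed.

Lemma box_supported_slice {n} M (g : 'rV[R]_n.+1 -> R) t :
  box_supported M g -> box_supported M (slice g t).
Proof.
by move=> Mg x i Mx; apply: (Mg _ (rshift 1 i : 'I_n.+1)); rewrite row_mx_tail.
Qed.

Lemma lipc_slice {n} (g : 'rV[R]_n.+1 -> R) t : lipc g -> lipc (slice g t).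
Proof.
move=> [M [L [M0 L0 Lg Mg]]]; exists M, L; split => //.
  exact: coord_lipschitz_slice.
exact: box_supported_slice.
Qed.

(** The integral of a non-negative function is a supremum over the simple functions below it, so
    monotonicity needs no measurability. *)
Lemma le_integral_nonmeas (f1 f2 : R -> \bar R) :
  (forall x, 0 <= f1 x)%E -> (forall x, f1 x <= f2 x)%E ->
  (\int[mu]_x f1 x <= \int[mu]_x f2 x)%E.
Proof.
move=> f0 f12; rewrite !ge0_integralTE//; last first.
  by move=> x; exact: le_trans (f12 x).
by apply: le_ereal_sup => _ [/= h hf <-]; exists h => // x; exact: le_trans (f12 x).
Qed.

Lemma lebint_ge0 {n} (g : 'rV[R]_n -> \bar R) :
  (forall x, 0 <= g x)%E -> (0 <= lebint_Rn g)%E.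
Proof.
by elim: n g => [|n IH] g g0 //=; apply: integral_ge0 => t _; apply: IH.
Qed.

Lemma lebint_le {n} (g h : 'rV[R]_n -> \bar R) : (forall x, 0 <= g x)%E ->
  (forall x, g x <= h x)%E -> (lebint_Rn g <= lebint_Rn h)%E.
Proof.
elim: n g h => [|n IH] g h g0 gh //=; apply: le_integral_nonmeas => t.
  exact: lebint_ge0.
exact: IH.
Qed.

Lemma lebint0 {n} : lebint_Rn (fun _ : 'rV[R]_n => 0%E) = 0%E.
Proof.
by elim: n => [|n IH] //=; rewrite integral0_eq.
Qed.

(** From any point of the box, a step of length [2 * M + 1] along the first axis leaves the box,
    where [g] vanishes. *)
Lemma box_supported_bound {n} M L (g : 'rV[R]_n.+1 -> R) : 0 <= M -> 0 <= L ->
  coord_lipschitz L g -> box_supported M g ->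
  forall x, `|g x| <= L * (2 * M + 1).
Proof.
move=> M0 L0 Lg Mg x; have := Lg x ord0 (2 * M + 1).
have [Mx|xM] := ltP M `|x 0 ord0|.
  by rewrite (Mg x ord0 Mx) normr0 mulr_ge0//; lra.
rewrite [g (_ + _)](Mg _ ord0) ?sub0r ?normrN ?[`|2 * M + 1|]ger0_norm//; first lra.
by rewrite !mxE eqxx mulr1 ltr_normr; move: xM; rewrite ler_norml => /andP[]; lra.
Qed.

Lemma lipschitz_continuous (K : R) (G : R -> R) :
  (forall t u, `|G t - G u| <= K * `|t - u|) -> continuous G.
Proof.
move=> GK t; have K0 : 0 <= K.
  by have := GK 1 0; rewrite subr0 normr1 mulr1; apply: le_trans.
apply/cvgrPdist_le => e e0; near=> u.
apply: le_trans (GK _ _) _.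
rewrite (@le_trans _ _ ((K + 1) * `|t - u|))// ?ler_wpM2r//; first lra.
rewrite mulrC -ler_pdivlMr; last lra.
by near: u; apply: cvgr_dist_le => //; apply: divr_gt0; lra.
Unshelve. all: by end_near. Qed.

(* This makes the inner integral of a Lipschitz function Lipschitz, hence
   measurable, in the outer variable. *)
Definition uniform_perturbation n := forall M L L' (d : R) (g h : 'rV[R]_n -> R),
  0 <= M -> 0 <= L -> 0 <= L' -> 0 <= d ->
  coord_lipschitz L g -> coord_lipschitz L' h ->
  box_supported M g -> box_supported M h ->
  (forall x, 0 <= g x) -> (forall x, 0 <= h x) ->
  (forall x, g x <= h x + d) ->
  (lebint_Rn (fun x => (g x)%:E)
   <= lebint_Rn (fun x => (h x)%:E) + (d * (2 * M) ^+ n)%:E)%E.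

(** The perturbation property is a hypothesis so that this lemma can serve inside the induction
    proving it. Finiteness is the case where the second function is 0 and [d] is a sup bound;
    continuity compares the slices at [t] and [u], which differ by at most [L * |t - u|]. *)
Lemma slice_integral {n} M L (g : 'rV[R]_n.+1 -> R) : uniform_perturbation n ->
  0 <= M -> 0 <= L -> coord_lipschitz L g -> box_supported M g ->
  (forall x, 0 <= g x) ->
  exists G : R -> R, [/\ forall t, lebint_Rn (fun y => (slice g t y)%:E) = (G t)%:E,
    forall t, 0 <= G t, continuous G & forall t, M < `|t| -> G t = 0].
Proof.
move=> P M0 L0 Lg Mg g0.
have I0 t : (0 <= lebint_Rn (fun y => (slice g t y)%:E))%E.
  by apply: lebint_ge0 => x; rewrite lee_fin; exact: g0.
have fin t : lebint_Rn (fun y => (slice g t y)%:E) \is a fin_num.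
  rewrite ge0_fin_numE//.
  have B x : g x <= L * (2 * M + 1).
    by apply: le_trans (ler_norm _) _; exact: box_supported_bound Lg Mg x.
  have B0 : 0 <= L * (2 * M + 1) by rewrite mulr_ge0//; lra.
  have := P M L 0 (L * (2 * M + 1)) (slice g t) (fun=> 0) M0 L0 (lexx _).
  rewrite lebint0 add0e => H; apply: le_lt_trans (H _ _ _ _ _ _ _ _) _ => //.
  - exact: coord_lipschitz_slice.
  - by move=> x i h; rewrite subrr normr0 mul0r.
  - exact: box_supported_slice.
  - by move=> x; exact: g0.
  - by move=> x; rewrite add0r; exact: B.
  - by rewrite ltry.
pose G t := fine (lebint_Rn (fun y => (slice g t y)%:E)).
have GE t : lebint_Rn (fun y => (slice g t y)%:E) = (G t)%:E by rewrite fineK.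
exists G; split => //.
- by move=> t; rewrite fine_ge0.
- have D t u : G t <= G u + L * `|t - u| * (2 * M) ^+ n.
    rewrite -lee_fin EFinD -!GE.
    apply: (P M L L) => //; rewrite ?mulr_ge0//.
    + exact: coord_lipschitz_slice.
    + exact: coord_lipschitz_slice.
    + exact: box_supported_slice.
    + exact: box_supported_slice.
    + by move=> x; exact: g0.
    + by move=> x; exact: g0.
    + move=> x; rewrite -lerBlDl (le_trans (ler_norm _))//.
      by rewrite /slice -{1}(subrKC u t) row_mx_shift_head; exact: Lg.
  apply: (@lipschitz_continuous (L * (2 * M) ^+ n)) => t u.
  have := D u t; have := D t u; rewrite (distrC u t) ler_distl mulrAC; lra.
- move=> t Mt; rewrite /G (_ : (fun y => _) = fun=> 0%E) ?lebint0//.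
  by apply/funext => y; rewrite /slice (Mg _ ord0) ?row_mx_head.
Qed.

Lemma lebint_perturb n : uniform_perturbation n.
Proof.
elim: n => [|n IH] M L L' d g h M0 L0 L'0 d0 Lg Lh Mg Mh g0 h0 gh.
  by rewrite /= expr0 mulr1 -EFinD lee_fin.
have [G [GE G0 cG MG]] := slice_integral M L g IH M0 L0 Lg Mg g0.
have [H [HE H0 cH MH]] := slice_integral M L' h IH M0 L'0 Lh Mh h0.
have mH : measurable_fun [set: R] (fun x => (H x)%:E).
  by apply/measurable_EFinP; exact: continuous_measurable_fun.
have GH t : G t <= H t + d * (2 * M) ^+ n.
  rewrite -lee_fin EFinD -GE -HE; apply: (IH M L L') => //.
  - exact: coord_lipschitz_slice.
  - exact: coord_lipschitz_slice.
  - exact: box_supported_slice.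
  - exact: box_supported_slice.
  - by move=> x; exact: g0.
  - by move=> x; exact: h0.
  - by move=> x; exact: gh.
rewrite /=; under eq_integral do rewrite GE.
under [X in (_ <= X + _)%E]eq_integral do rewrite HE.
(* The new factor [2 * M] is the length of [[-M, M]]: outside this interval [G] vanishes, so the
   error has to be added only there. *)
have -> : ((d * (2 * M) ^+ n.+1)%:E =
    \int[mu]_(x in `[(- M)%R, M]) (cst (d * (2 * M) ^+ n)%:E) x)%E.
  rewrite integral_cst// [X in (_ * X)%E]lebesgue_measure_itv/= lte_fin.
  case: ifPn => [_|NM]; first by rewrite -EFinD -EFinM exprS; congr _%:E; ring.
  have -> : M = 0 by move: NM; rewrite -leNgt; lra.
  by rewrite mule0 mulr0 exprS mul0r mulr0.
rewrite [X in (_ <= _ + X)%E]integral_mkcond -ge0_integralD//.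
- apply: le_integral_nonmeas => t; first by rewrite lee_fin.
  rewrite patchE; case: ifPn => [_|]; first by rewrite -EFinD lee_fin.
  rewrite notin_setE /= in_itv /= => /negP Mt.
  by rewrite MG ?adde0 ?lee_fin// ltNge ler_norml.
- by move=> t _; rewrite lee_fin.
- by move=> t _; apply: erestrict_ge0 => ? _ /=; rewrite lee_fin mulr_ge0// exprn_ge0//; lra.
- by apply/(measurable_restrictT _ _).1.
Qed.

Lemma lipc_slice_integral {n} (g : 'rV[R]_n.+1 -> R) : lipc g ->
  (forall x, 0 <= g x) ->
  exists G : R -> R, [/\ forall t, lebint_Rn (fun y => (slice g t y)%:E) = (G t)%:E,
    forall t, 0 <= G t & continuous G].
Proof.
move=> [M [L [M0 L0 Lg Mg]]] g0.
by have [G [? ? ? ?]] := slice_integral M L g (@lebint_perturb n) M0 L0 Lg Mg g0; exists G.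
Qed.

(** * Finiteness and linearity of the iterated integral *)

Lemma lebint_fin_num {n} (g : 'rV[R]_n -> R) : lipc g -> (forall x, 0 <= g x) ->
  lebint_Rn (fun x => (g x)%:E) \is a fin_num.
Proof.
case: n g => [//|n] g [M [L [M0 L0 Lg Mg]]] g0.
have I0 : (0 <= lebint_Rn (fun y => (g y)%:E))%E by apply: lebint_ge0.
rewrite ge0_fin_numE//.
have B0 : 0 <= L * (2 * M + 1) by rewrite mulr_ge0//; lra.
have := @lebint_perturb n.+1 M L 0 (L * (2 * M + 1)) g (fun=> 0) M0 L0 (lexx _).
rewrite lebint0 add0e => H; apply: le_lt_trans (H _ _ _ _ _ _ _ _) _ => //.
- by move=> x i h; rewrite subrr normr0 mul0r.
- move=> x; rewrite add0r.
  by apply: le_trans (ler_norm _) _; exact: box_supported_bound Lg Mg x.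
- by rewrite ltry.
Qed.

(** At each level of the induction, one-dimensional additivity needs measurable inner integrals;
    they are continuous in the outer variable. *)
Lemma lebintD {n} (g h : 'rV[R]_n -> R) : lipc g -> lipc h ->
  (forall x, 0 <= g x) -> (forall x, 0 <= h x) ->
  lebint_Rn (fun x => (g x + h x)%:E) =
  (lebint_Rn (fun x => (g x)%:E) + lebint_Rn (fun x => (h x)%:E))%E.
Proof.
elim: n g h => [//|n IH] g h lg lh g0 h0 /=.
have [G [GE G0 cG]] := lipc_slice_integral g lg g0.
have [H [HE H0 cH]] := lipc_slice_integral h lh h0.
under eq_integral => t _.
  rewrite (IH (slice g t) (slice h t)); [|exact: lipc_slice..| |].
  - by rewrite GE HE; over.
  - by move=> x; exact: g0.
  - by move=> x; exact: h0.
under [X in _ = (X + _)%E]eq_integral do rewrite GE.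
under [X in _ = (_ + X)%E]eq_integral do rewrite HE.
rewrite ge0_integralD//.
- by move=> t _; rewrite lee_fin.
- by apply/measurable_EFinP; exact: continuous_measurable_fun.
- by move=> t _; rewrite lee_fin.
- by apply/measurable_EFinP; exact: continuous_measurable_fun.
Qed.

Lemma lebintZ {n} (g : 'rV[R]_n -> R) c : lipc g -> (forall x, 0 <= g x) ->
  0 <= c ->
  lebint_Rn (fun x => (c * g x)%:E) = (c%:E * lebint_Rn (fun x => (g x)%:E))%E.
Proof.
move=> + + c0; elim: n g => [//|n IH] g lg g0 /=.
have [G [GE G0 cG]] := lipc_slice_integral g lg g0.
under eq_integral => t _.
  rewrite (IH (slice g t)); [|exact: lipc_slice|].
  - by rewrite GE; over.
  - by move=> x; exact: g0.
under [X in _ = (_ * X)%E]eq_integral do rewrite GE.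
rewrite ge0_integralZl_EFin//.
- by move=> t _; rewrite lee_fin.
- by apply/measurable_EFinP; exact: continuous_measurable_fun.
Qed.

End lebint.

(** * Translations and continuously differentiable functions *)

Section translation.
Context {R : realType}.
Implicit Types (n : nat) (M L : R).
Local Notation mu := (@lebesgue_measure R).

Lemma integral_shift (G : R -> R) (h : R) : continuous G ->
  (forall t, 0 <= G t) ->
  (\int[mu]_t (G (t + h))%:E = \int[mu]_t (G t)%:E)%E.
Proof.
move=> cG G0; pose F (t : R) := t + h.
have isF (t : R) : is_derive t 1 F 1.
  have -> : F = id + cst h by apply/funext.
  by apply: is_derive_eq; rewrite addr0.
have dF : derive1 F = cst 1 by apply/funext => t; rewrite derive1E derive_val.
rewrite (@increasing_ge0_integration_by_substitutionT _ F G)//.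
- by apply: eq_integral => t _; rewrite dF /= -[in RHS]/(G (t + h) * 1) mulr1.
- by move=> x y xy; rewrite ltrD2r.
- by rewrite dF; exact: cst_continuous.
- by rewrite dF; exact: is_cvg_cst.
- by rewrite dF; exact: is_cvg_cst.
- apply/cvgrNyPle => A; near=> t; rewrite /F -lerBrDr; near: t.
  exact: nbhs_ninfty_le (num_real _).
- apply/cvgryPge => A; near=> t; rewrite /F -lerBlDr; near: t.
  exact: nbhs_pinfty_ge (num_real _).
Unshelve. all: by end_near. Qed.

(** The induction hypothesis absorbs the tail of [h] in each slice, and [integral_shift] absorbs its
    first coordinate in the outer integral. *)
Lemma lebint_translate {n} (g : 'rV[R]_n -> R) (h : 'rV[R]_n) : lipc g ->
  (forall x, 0 <= g x) ->
  lebint_Rn (fun x => (g (x + h))%:E) = lebint_Rn (fun x => (g x)%:E).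
Proof.
elim: n g h => [|n IH] g h lg g0 /=; first by congr (g _)%:E; apply/rowP => -[].
have [G [GE G0 cG]] := lipc_slice_integral g lg g0.
under [RHS]eq_integral do rewrite GE.
rewrite -(integral_shift G (h 0 ord0))//; apply: eq_integral => t _.
rewrite -GE -(IH (slice g (t + h 0 ord0)) (rsubmx (h : 'rV_(1 + n))))//; last first.
- by move=> x; exact: g0.
- exact: lipc_slice.
congr lebint_Rn; apply/funext => y; rewrite /slice; congr (g _)%:E.
pose k : 'rV[R]_(1 + n) := h.
have -> : const_mx (t + h 0 ord0) = const_mx t + lsubmx k :> 'rV[R]_1.
  apply/rowP => i; rewrite !mxE; congr (_ + h _ _).
  by apply/val_inj; rewrite /= ord1.
by rewrite -add_row_mx hsubmxK.
Qed.

Lemma lipc_translate {n} (g : 'rV[R]_n -> R) (h : 'rV[R]_n) : lipc g ->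
  lipc (fun x => g (x + h)).
Proof.
move=> [M [L [M0 L0 Lg Mg]]].
exists (M + \sum_i `|h 0 i|), L; split => //.
- by rewrite addr_ge0// sumr_ge0.
- by move=> x i k; rewrite addrAC; exact: Lg.
- move=> x i xM; apply: (Mg _ i); rewrite mxE.
  have : `|h 0 i| <= \sum_i `|h 0 i|.
    by rewrite (bigD1 i)//= lerDl sumr_ge0.
  have := ler_normB (x 0 i + h 0 i) (h 0 i); rewrite addrK; lra.
Qed.

Lemma lipcB {n} (g h : 'rV[R]_n -> R) : lipc g -> lipc h ->
  lipc (fun x => g x - h x).
Proof.
move=> [M [L [M0 L0 Lg Mg]]] [N [K [N0 K0 Kh Nh]]].
exists (M + N), (L + K); split; [exact: addr_ge0..| |].
- move=> x i k; have := Lg x i k; have := Kh x i k; rewrite !ler_norml; lra.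
- move=> x i xMN; rewrite (Mg x i) ?(Nh x i) ?subr0//; lra.
Qed.

Lemma powR_lipschitz (p B a b : R) : 1 <= p -> 0 <= a <= B -> 0 <= b <= B ->
  `|a `^ p - b `^ p| <= p * B `^ (p - 1) * `|a - b|.
Proof.
move=> p1; wlog ba : a b / b <= a.
  move=> H aB bB; have [ba|/ltW ab] := leP b a; first exact: H.
  by rewrite distrC (distrC a); exact: H.
move=> /andP[a0 aB] /andP[b0 bB].
have powB x : 0 <= x <= B -> x `^ (p - 1) <= B `^ (p - 1).
  by move=> /andP[x0 xB]; apply: ge0_ler_powR; rewrite ?nnegrE//; lra.
(* For [0 < b] the power is differentiable on the closed segment, which gives the continuity
   required by the mean value theorem. The case [b = 0] follows directly from
   [a^p = a * a^(p-1)]. *)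
have [b_eq0|bn0] := eqVneq b 0.
  rewrite b_eq0 powR0 ?subr0; last by rewrite gt_eqF//; lra.
  rewrite !ger0_norm ?powR_ge0// -mulr_powRB1//; last lra.
  rewrite mulrC ler_wpM2r// (le_trans (powB a _)) ?a0//.
  by rewrite ler_peMl// powR_ge0.
have b_gt0 : 0 < b by rewrite lt0r bn0.
have [||c cab] := @MVT_segment _ (@powR R ^~ p) (fun x => p * x `^ (p - 1)) b a ba.
- move=> x; rewrite in_itv/= => /andP[bx _].
  by apply: is_derive1_powR; exact: lt_trans bx.
- apply: derivable_within_continuous => x; rewrite in_itv/= => /andP[bx _].
  by apply: derivable_powR; rewrite in_itv/= andbT; exact: lt_le_trans bx.
move=> ->; move: cab; rewrite in_itv/= => /andP[bc ca].
rewrite normrM ler_wpM2r// ger0_norm ?mulr_ge0 ?powR_ge0//; last lra.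
rewrite ler_wpM2l//; first lra.
by apply: powB; rewrite (le_trans b0 bc) (le_trans ca aB).
Qed.

Lemma lipc_powR {n} (g : 'rV[R]_n -> R) p : 1 <= p -> lipc g ->
  lipc (fun x => `|g x| `^ p).
Proof.
(* Dimension 0 is split off because the sup bound [B] comes from moving along a first coordinate. *)
move=> p1; case: n g => [|n] g.
  by move=> _; exists 0, 0; split => // x [].
move=> [M [L [M0 L0 Lg Mg]]].
pose B := L * (2 * M + 1).
have gB x : 0 <= `|g x| <= B.
  by rewrite normr_ge0/=; exact: box_supported_bound.
have C0 : 0 <= p * B `^ (p - 1) by rewrite mulr_ge0 ?powR_ge0//; lra.
exists M, (p * B `^ (p - 1) * L); split => //.
- by rewrite mulr_ge0.
- move=> x i h; apply: (le_trans (powR_lipschitz _ _ _ _ p1 (gB _) (gB _))).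
  rewrite -(mulrA _ L) ler_wpM2l//; apply: le_trans (Lg x i h).
  exact: ler_dist_dist.
- by move=> x i xM; rewrite (Mg x i)// normr0 powR0// gt_eqF//; lra.
Qed.

(** * Bounded supports and partial derivatives *)

Lemma coord_le_norm n (x : 'rV[R]_n) i : `|x 0 i| <= `|x|.
Proof.
by rewrite [leRHS]/Num.norm/= mx_normrE; apply/bigmax_geP; right; exists (0, i).
Qed.

Lemma box_supported_bounded {n} (f : 'rV[R]_n -> R) (Omega : set 'rV[R]_n) :
  bounded_set Omega -> support_in f Omega ->
  exists2 M, 0 <= M & box_supported M f.
Proof.
move=> [M [_ bM]] fO; exists (`|M| + 1); first by rewrite addr_ge0.
move=> x i Mx; apply/eqP/negPn/negP => fx.
have /bM : M < `|M| + 1 by rewrite (le_lt_trans (ler_norm M))// ltrDl.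
move=> /(_ x (fO x (@subset_closure _ [set x | f x != 0] x fx))); apply/negP; rewrite -ltNge.
exact: (lt_le_trans Mx (coord_le_norm _ _ _)).
Qed.

(** The strict inequality [M < |x_i|] persists near [x], so [f] is locally zero there. *)
Lemma derive_box_supported {n} (f : 'rV[R]_n -> R) M (v : 'rV[R]_n) :
  box_supported M f -> box_supported M (fun x => 'D_v f x).
Proof.
move=> Mf x i Mx; rewrite -[RHS](derive_cst (0 : R) x v).
apply: near_eq_derive => //; near=> y; apply: (Mf y i).
near: y; apply: cvgr_norm_gt Mx; exact: coord_continuous.
Unshelve. all: by end_near. Qed.

Lemma is_derive_line {n} (f : 'rV[R]_n -> R) (x v : 'rV[R]_n) (h : R) :
  derivable f (x + h *: v) v ->
  is_derive h 1 (fun t => f (x + t *: v)) ('D_v f (x + h *: v)).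
Proof.
have E : (fun t : R => t^-1 *: (f (x + (t *: 1 + h) *: v) - f (x + h *: v))) =
  (fun t : R => t^-1 *: (f (t *: v + (x + h *: v)) - f (x + h *: v))).
  apply/funext => t; congr (_ *: (f _ - _)).
  by rewrite [t *: 1]mulr1 scalerDl addrCA.
by move=> df; split; rewrite /derivable /derive /= /shift /= E.
Qed.

(** Partial derivatives are continuous, hence bounded on the compact cube of radius [M], and they
    vanish off it. The mean value theorem along each axis then gives the Lipschitz bound, with the
    sum of the bounds as common constant. *)
Lemma C1_lipc {n} (f : 'rV[R]_n -> R) (Omega : set 'rV[R]_n) :
  bounded_set Omega -> support_in f Omega -> C1 f -> lipc f.
Proof.
move=> bO fO [df cf].
have [M M0 Mf] := box_supported_bounded f Omega bO fO.
have bnd i : exists L, forall x, `|'D_(evec i) f x| <= L.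
  pose K : set 'rV[R]_n := [set x | forall j, x ord0 j \in `[(- M), M]].
  have cK : compact K.
    by apply: (@rV_compact _ _ (fun=> `[(- M), M]%classic)) => _; exact: segment_compact.
  have /compact_bounded[B [_ bB]] : compact ((fun x => 'D_(evec i) f x) @` K).
    by apply: continuous_compact => //; apply: continuous_subspaceT; exact: cf.
  exists (`|B| + 1) => x.
  have [Kx|nKx] := pselect (K x).
    apply: bB; last by exists x.
    by rewrite (le_lt_trans (ler_norm B))// ltrDl.
  have [j Mx] : exists j, M < `|x ord0 j|.
    apply: contrapT => /forallNP H; apply: nKx => j.
    by rewrite in_itv/= -ler_norml leNgt; exact/negP.
  by rewrite (derive_box_supported _ _ _ Mf x j Mx) normr0 addr_ge0.
have {bnd} [L HL] : exists L : 'I_n -> R, forall i x, `|'D_(evec i) f x| <= L i.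
  by exists (fun i => projT1 (cid (bnd i))) => i x; case: cid.
have L0 i : 0 <= L i by apply: le_trans (HL i 0).
exists M, (\sum_i L i); split => //; first exact: sumr_ge0.
move=> x i h.
have Li : L i <= \sum_i L i by rewrite (bigD1 i)//= lerDl sumr_ge0.
have isd t := is_derive_line f x (evec i) t (df _ i).
have ctn (a b : R) : {within `[a, b], continuous (fun t => f (x + t *: evec i))}.
  by apply: derivable_within_continuous => t _; have [] := isd t.
have [h0|/ltW h0] := leP 0 h.
  have [|c _] := MVT_segment h0 (fun t _ => isd t); first exact: ctn.
  rewrite scale0r addr0 subr0 => ->; rewrite normrM ler_wpM2r//.
  exact: le_trans (HL _ _) Li.
have [|c _] := MVT_segment h0 (fun t _ => isd t); first exact: ctn.
rewrite scale0r addr0 sub0r => E; rewrite distrC E normrM normrN ler_wpM2r//.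
exact: le_trans (HL _ _) Li.
Qed.

End translation.

(** * Finite differences *)

Section differences.
Context {R : realType}.
Implicit Types (n k : nat) (p : R).

Lemma powR_convex p (t x y : R) : 1 <= p -> 0 <= t <= 1 -> 0 <= x -> 0 <= y ->
  (t * x + (1 - t) * y) `^ p <= t * x `^ p + (1 - t) * y `^ p.
Proof.
move=> p1 /andP[t0 t1] x0 y0.
have := @convex_powR R p p1 (Itv01 t0 t1) x y.
rewrite !convRE /=; apply; rewrite inE/= in_itv/= ?x0 ?y0//.
Qed.

Lemma powR_sum_le p k (a : nat -> R) : 1 <= p -> (forall j, 0 <= a j) ->
  (\sum_(j < k.+1) a j) `^ p <= k.+1%:R `^ p * k.+1%:R^-1 * \sum_(j < k.+1) a j `^ p.
Proof.
move=> p1 a0; elim: k => [|k IH].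
  by rewrite !big_ord_recr !big_ord0/= !add0r powR1 invr1 !mul1r.
rewrite big_ord_recr [X in _ * X]big_ord_recr/=.
set S := \sum_(j < k.+1) a j in IH *; set T := \sum_(j < k.+1) _ in IH *.
have S0 : 0 <= S by apply: sumr_ge0.
have K0 : 0 < k.+1%:R :> R by rewrite ltr0n.
have K0' : 0 < k.+2%:R :> R by rewrite ltr0n.
have KE : k.+2%:R = k.+1%:R + 1 :> R by rewrite -natr1.
set K := k.+1%:R in IH K0 KE *; set K' := k.+2%:R in K0' KE *.
(* The mean of all [k.+2] terms is a convex combination of the mean [S / K] of the first [k.+1]
   terms and the last term, so convexity applies. *)
have -> : S + a k.+1 = K' * (K / K' * (S / K) + (1 - K / K') * a k.+1).
  by rewrite KE; field; rewrite gt_eqF//= -KE gt_eqF.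
have [K0w K0w'] := (ltW K0, ltW K0').
have t1 : 0 <= K / K' <= 1.
  by apply/andP; split; [rewrite divr_ge0 ?ltW|rewrite ler_pdivrMr// mul1r; lra].
rewrite (powRM _ (ltW K0')); last first.
  by case/andP: t1 => ? ?; rewrite addr_ge0// mulr_ge0 ?divr_ge0// subr_ge0.
rewrite -[leRHS]mulrA ler_wpM2l ?powR_ge0//.
apply: (le_trans (powR_convex _ _ _ _ p1 t1 (divr_ge0 S0 (ltW K0)) (a0 _))).
have -> : 1 - K / K' = K'^-1 by rewrite KE; field; rewrite gt_eqF//; lra.
rewrite (mulrC K) -mulrA -mulrDr ler_wpM2l ?invr_ge0// lerD2r.
rewrite powRM ?invr_ge0// -[K^-1]powR_inv1// powRAC powR_inv1 ?powR_ge0//.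
have Kp : 0 < K `^ p by rewrite powR_gt0.
rewrite mulrA ler_pdivrMr//.
apply: (le_trans (ler_wpM2l (ltW K0) IH)).
by rewrite [leLHS](_ : _ = T * K `^ p)//; field; rewrite gt_eqF.
Qed.

Lemma lipc0 n : lipc (fun _ : 'rV[R]_n => 0).
Proof. by exists 0, 0; split => // x i h; rewrite subrr normr0 mul0r. Qed.

Lemma lipcD n (g h : 'rV[R]_n -> R) : lipc g -> lipc h ->
  lipc (fun x => g x + h x).
Proof.
move=> lg lh; have := lipcB _ _ lg (lipcB _ _ (lipc0 n) lh).
by congr lipc; apply/funext => x; rewrite sub0r opprK.
Qed.

(** Both claims are proved together because additivity of the integral requires the partial sum to
    be in the class [lipc]. *)
Lemma lebint_sum_translate n (g : 'rV[R]_n -> R) (h : nat -> 'rV[R]_n) k :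
  lipc g -> (forall x, 0 <= g x) ->
  lipc (fun x => \sum_(j < k) g (x + h j)) /\
  lebint_Rn (fun x => (\sum_(j < k) g (x + h j))%:E) =
  (k%:R%:E * lebint_Rn (fun x => (g x)%:E))%E.
Proof.
move=> lg g0; elim: k => [|k [IHl IH]].
  have E x : \sum_(j < 0) g (x + h j) = 0 by rewrite big_ord0.
  split; first by under eq_fun do rewrite E; exact: lipc0.
  by under eq_fun do rewrite E; rewrite lebint0 mul0e.
have E x : \sum_(j < k.+1) g (x + h j) = \sum_(j < k) g (x + h j) + g (x + h k).
  by rewrite big_ord_recr.
have lgk := lipc_translate g (h k) lg.
split; first by under eq_fun do rewrite E; exact: lipcD.
under eq_fun do rewrite E.
rewrite lebintD//; last by move=> x; apply: sumr_ge0.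
rewrite IH lebint_translate//.
rewrite -(fineK (lebint_fin_num g lg g0)) -EFinM -EFinD -EFinM.
by rewrite -natr1 mulrDl mul1r.
Qed.

Lemma lipc_fdiff_powR n p h (f : 'rV[R]_n -> R) : 1 <= p -> lipc f ->
  lipc (fun x => `|fdiff h f x| `^ p).
Proof.
by move=> p1 lf; apply: lipc_powR => //; apply: lipcB => //; exact: lipc_translate.
Qed.

Lemma fdiff_telescope n (f : 'rV[R]_n -> R) h k x :
  fdiff (k%:R *: h) f x = \sum_(j < k) fdiff h f (x + j%:R *: h).
Proof.
rewrite /fdiff; elim: k => [|k IH]; first by rewrite big_ord0 scale0r addr0 subrr.
have -> : x + k.+1%:R *: h = x + k%:R *: h + h.
  by rewrite -natr1 scalerDl scale1r addrA.
by rewrite big_ord_recr/= -IH; ring.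
Qed.

(** The power-mean inequality costs [k.+1 ^ (p-1)], and the [k.+1] translates, all with the same
    integral, supply the remaining factor [k.+1]. *)
Lemma lebint_fdiff_scale n p (f : 'rV[R]_n -> R) h k : 1 <= p -> lipc f ->
  (lebint_Rn (fun x => (`|fdiff (k.+1%:R *: h) f x| `^ p)%:E) <=
   (k.+1%:R `^ p)%:E * lebint_Rn (fun x => (`|fdiff h f x| `^ p)%:E))%E.
Proof.
move=> p1 lf; set G := fun x => `|fdiff h f x| `^ p.
have lG : lipc G by exact: lipc_fdiff_powR.
have G0 x : 0 <= G x by exact: powR_ge0.
have [lS SE] := lebint_sum_translate _ G (fun j => j%:R *: h) k.+1 lG G0.
apply: (@le_trans _ _ (lebint_Rn (fun x =>
    (k.+1%:R `^ p * k.+1%:R^-1 * \sum_(j < k.+1) G (x + j%:R *: h))%:E))).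
  apply: lebint_le => x; rewrite lee_fin ?powR_ge0//.
  apply: (le_trans _ (powR_sum_le p k (fun j => `|fdiff h f (x + j%:R *: h)|) p1 _)) => //.
  apply: ge0_ler_powR; rewrite ?nnegrE//; [lra|exact: sumr_ge0|].
  by rewrite fdiff_telescope; exact: ler_norm_sum.
rewrite lebintZ//; last by move=> x; apply: sumr_ge0.
by rewrite SE muleA -EFinM mulfVK// pnatr_eq0.
Qed.

Lemma lebint_fdiff_disjoint n p (f : 'rV[R]_n -> R) h : 1 <= p -> lipc f ->
  (forall x, f x = 0 \/ f (x + h) = 0) ->
  lebint_Rn (fun x => (`|fdiff h f x| `^ p)%:E) =
  (2%:E * lebint_Rn (fun x => (`|f x| `^ p)%:E))%E.
Proof.
move=> p1 lf dis; have pn0 : p != 0 by rewrite gt_eqF//; lra.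
have -> : (fun x => (`|fdiff h f x| `^ p)%:E) =
    fun x => (`|f (x + h)| `^ p + `|f x| `^ p)%:E.
  apply/funext => x; rewrite /fdiff; congr _%:E.
  by case: (dis x) => ->; rewrite ?subr0 ?sub0r ?normrN normr0 powR0// ?addr0 ?add0r.
have lp := lipc_powR f p p1 lf.
have lph := lipc_translate _ h lp.
have fin := lebint_fin_num _ lp (fun x => powR_ge0 _ _).
rewrite (lebintD (fun x => `|f (x + h)| `^ p) (fun x => `|f x| `^ p))//;
  try by move=> x; exact: powR_ge0.
rewrite (lebint_translate (fun x => `|f x| `^ p))//.
by rewrite -(fineK fin) -EFinD -EFinM mulr_natl mulr2n.
Qed.

(** * Width of a set in a direction *)

Lemma dotvDl n (x y z : 'rV[R]_n) : dotv (x + y) z = dotv x z + dotv y z.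
Proof. by rewrite /dotv -big_split; apply: eq_bigr => i _; rewrite mxE mulrDl. Qed.

Lemma dotvZl n (t : R) (x z : 'rV[R]_n) : dotv (t *: x) z = t * dotv x z.
Proof. by rewrite /dotv mulr_sumr; apply: eq_bigr => i _; rewrite mxE mulrA. Qed.

Lemma le_width n (Omega : set 'rV[R]_n) xi x y : bounded_set Omega ->
  Omega x -> Omega y -> dotv (x - y) xi <= width Omega xi.
Proof.
move=> [M [_ bM]] Ox Oy; apply: ub_le_sup; last by exists x => //; exists y.
have bO z : Omega z -> `|z| <= `|M| + 1.
  by move=> Oz; apply: bM => //; rewrite (le_lt_trans (ler_norm M))// ltrDl.
(* An explicit upper bound makes [sup] a genuine supremum rather than its default value; coordinates
   of two points of [Omega] differ by at most [2 * (|M| + 1)]. *)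
exists (\sum_i (2 * (`|M| + 1)) * `|xi 0 i|) => _ [a Oa [b Ob <-]].
apply: ler_sum => i _; apply: (le_trans (ler_norm _)).
rewrite normrM ler_wpM2r// (le_trans (coord_le_norm _ _ _))//.
apply: (le_trans (ler_normB _ _)); have := bO a Oa; have := bO b Ob; lra.
Qed.

(* An open set cannot attain its width: move [x] a little along [xi]. *)
Lemma lt_width n (Omega : set 'rV[R]_n) xi x y : bounded_set Omega ->
  open Omega -> unit_sphere xi ->
  Omega x -> Omega y -> dotv (x - y) xi < width Omega xi.
Proof.
move=> bO oO uxi Ox Oy.
have : \forall t \near (0:R)^'+, Omega (x + t *: xi).
  have : x + t *: xi @[t --> (0:R)^'+] --> x + (0:R) *: xi.
    apply: cvgD; first exact: cvg_cst.
    by apply: cvgZl; apply: cvg_at_right_filter; exact: cvg_id.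
  by apply; apply: open_nbhs_nbhs; rewrite scale0r addr0; split.
move=> H; have [t [Ot t0]] : exists t, Omega (x + t *: xi) /\ 0 < t.
  near (0:R)^'+ => t; exists t; split; first by near: t.
  by near: t; exact: nbhs_right_gt.
have e : dotv (x + t *: xi - y) xi = dotv (x - y) xi + t.
  by rewrite addrAC (dotvDl _ (x - y)) (dotvZl _ t) uxi mulr1.
apply: lt_le_trans (le_width _ _ xi _ _ bO Ot Oy).
by rewrite e ltrDl.
Unshelve. all: by end_near. Qed.

End differences.

(** * Constants *)

Section constants.
Context {R : realType}.
Implicit Types p q s u x y : R.

(** Weighted AM-GM for [y] and 1 with weights [u] and [1 - u]; at [u = 1] the conjugate exponent
    degenerates, so that case is separate. *)
Lemma powR_young u y : 0 < u <= 1 -> 0 <= y -> y `^ u <= u * y + (1 - u).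
Proof.
move=> /andP[u0 u1] y0; have [->|un1] := eqVneq u 1.
  by rewrite powRr1// mul1r subrr addr0.
have u1' : u < 1 by rewrite lt_neqAle un1.
have := @conjugate_powR R (y `^ u) 1 u^-1 (1 - u)^-1 (powR_ge0 _ _) ler01.
rewrite !invrK powR1 mulr1 -powRrM mulfV ?gt_eqF// powRr1// mul1r mulrC.
by apply; rewrite ?invr_gt0; lra.
Qed.

(** * Taylor bounds for sine and cosine, each derived from the preceding one by the sign of a
    derivative *)

Lemma ge0_derive_ge0 (f df : R -> R) x : 0 <= x ->
  (forall t : R, is_derive t 1 f (df t)) ->
  (forall t, 0 <= t -> 0 <= df t) -> f 0 <= f x.
Proof.
move=> x0 isf df0.
have [|c] := @MVT_segment _ f df 0 x x0 (fun t _ => isf t).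
  by apply: derivable_within_continuous => t _; have [] := isf t.
rewrite in_itv/= => /andP[c0 _] /eqP; rewrite subr_eq => /eqP ->.
by rewrite lerDr subr0 mulr_ge0// df0.
Qed.

Lemma sin_le_id x : 0 <= x -> sin x <= x.
Proof.
move=> x0; have : 0 - sin 0 <= x - sin x.
  apply: (@ge0_derive_ge0 (id - sin) (fun t => 1 - cos t)) => //.
by rewrite sin0; lra.
Qed.

Lemma cos_ge_quadratic x : 0 <= x -> 1 - x ^+ 2 / 2 <= cos x.
Proof.
move=> x0.
have isd (t : R) : is_derive t 1 (fun t : R => cos t + 2^-1 * t ^+ 2) (t - sin t).
  rewrite (_ : (fun t : R => _) = cos + 2^-1 \*: (id ^+ 2)); last exact/funext.
  by apply: is_derive_eq; rewrite /GRing.scale /= expr1; lra.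
have := @ge0_derive_ge0 _ _ x x0 isd.
rewrite cos0 expr0n /= => H; suff : 1 + 2^-1 * 0 <= cos x + 2^-1 * x ^+ 2 by lra.
by apply: H => t; rewrite subr_ge0; exact: sin_le_id.
Qed.

Lemma sin_ge_cubic x : 0 <= x -> x - x ^+ 3 / 6 <= sin x.
Proof.
move=> x0.
have isd (t : R) : is_derive t 1 (fun t : R => sin t - t + 6^-1 * t ^+ 3)
    (cos t - 1 + t ^+ 2 / 2).
  rewrite (_ : (fun t : R => _) = sin - id + 6^-1 \*: (id ^+ 3)); last exact/funext.
  by apply: is_derive_eq; rewrite /GRing.scale /=; lra.
have := @ge0_derive_ge0 _ _ x x0 isd.
rewrite sin0 expr0n /= => H.
suff : 0 - 0 + 6^-1 * 0 <= sin x - x + 6^-1 * x ^+ 3 by lra.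
by apply: H => t /cos_ge_quadratic; lra.
Qed.

(** The cubic Taylor bound with [pi <= 4], whence [pi^2 / 6 <= 8 / 3]. *)
Lemma sin_pi_mul_ge x : 0 <= x -> pi * x * (1 - 8 / 3 * x ^+ 2) <= sin (pi * x).
Proof.
move=> x0; have pi0 := @pi_ge0 R.
have pi4 : (pi : R) <= 4 by have := @pihalf_lt2 R; lra.
apply: le_trans (sin_ge_cubic _ _); last exact: mulr_ge0.
have -> : pi * x - (pi * x) ^+ 3 / 6 = pi * x * (1 - pi ^+ 2 / 6 * x ^+ 2) by ring.
rewrite ler_wpM2l ?mulr_ge0// lerD2l lerN2 ler_wpM2r ?sqr_ge0//.
nra.
Qed.

Lemma c_const_gt0 p : 1 <= p -> 0 < c_const p.
Proof.
move=> p1; rewrite /c_const; case: ifPn => // p1'.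
have pi0 := @pi_gt0 R.
have v1 : p^-1 < 1 by rewrite invf_lt1//; lra.
have v0 : 0 < p^-1 by rewrite invr_gt0; lra.
have piv : pi / p < pi by rewrite gtr_pMr.
rewrite !mulr_gt0 ?invr_gt0 ?powR_gt0 ?sin_gt0_pi ?piv ?andbT ?mulr_gt0//; lra.
Qed.

(* With v = 1/p and u = 1 - v, c_p = 2 v (pi u / sin (pi v)) (v / u)^u, and
   weighted AM-GM bounds (v / u)^u by 2 v. *)
Lemma c_const_le p : 1 <= p -> c_const p <= 9 / 4 * 2 `^ p^-1.
Proof.
move=> p1; rewrite /c_const; case: ifPn => [p1'|]; last first.
  rewrite -leNgt => p1'; have -> : p = 1 by lra.
  by rewrite invr1 powRr1//; lra.
have pi0 := @pi_gt0 R.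
set v := p^-1.
have v1 : v < 1 by rewrite invf_lt1//; lra.
have v0 : 0 < v by rewrite invr_gt0; lra.
have pE : p = v^-1 by rewrite invrK.
pose u := 1 - v.
have piv : pi * v < pi by rewrite gtr_pMr.
have sin0 : 0 < sin (pi * v) by rewrite sin_gt0_pi// piv mulr_gt0.
have powE : (p - 1) `^ (v - 1) <= 2 * v.
  have -> : p - 1 = (v / u)^-1.
    rewrite pE /u invf_div mulrBl mul1r mulfV ?gt_eqF//.
  rewrite -powR_inv1 ?divr_ge0//; try by rewrite /u; lra.
  rewrite -powRrM mulN1r opprB -/u.
  apply: le_trans (powR_young _ _ _ _) _.
  - by rewrite /u; lra.
  - by rewrite divr_ge0// /u; lra.
  - by rewrite mulrCA mulfV ?mulr1 /u; lra.
have two : 2 `^ u <= 2 - v.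
  by apply: le_trans (powR_young _ _ _ _) _; rewrite /u; lra.
have twoE : 2 `^ v * 2 `^ u = 2.
  by rewrite -powRD ?pnatr_eq0 ?implybT// /u subrKC powRr1.
(* This is what remains after multiplying the goal by [2^u] and using [two] and [powE]. The split at
   [v = 1/2], with [sin (pi v) = sin (pi u)], keeps the argument of the Taylor bound at most
   [pi / 2]. *)
have key : 8 * v ^+ 2 * (pi * u) * (2 - v) <= 9 * sin (pi * v).
  have [v2|v2] := leP v 2^-1.
    have /(ler_wpM2l (ler0n R 9)) := sin_pi_mul_ge _ (ltW v0); apply: le_trans.
    have -> : 8 * v ^+ 2 * (pi * u) * (2 - v) = pi * v * (8 * v * u * (2 - v)) by ring.
    rewrite [leRHS]mulrCA; apply: ler_wpM2l; first by rewrite mulr_ge0// ltW.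
    rewrite /u.
    (* The quadratic terms cancel, leaving [16 v + 8 v^3 <= 9], an equality at [v = 1/2]. *)
    have : v ^+ 3 <= 1 / 8 by nra.
    lra.
  have u0 : 0 <= u by rewrite /u; lra.
  have u2 : u <= 2^-1 by rewrite /u; lra.
  have -> : sin (pi * v) = sin (pi * u).
    have -> : pi * v = pi - pi * u by rewrite /u; ring.
    by rewrite sinB sinpi cospi mul0r mulN1r opprK add0r.
  have /(ler_wpM2l (ler0n R 9)) := sin_pi_mul_ge _ u0; apply: le_trans.
  have -> : 8 * v ^+ 2 * (pi * u) * (2 - v) = pi * u * (8 * v ^+ 2 * (2 - v)) by ring.
  rewrite [leRHS]mulrCA; apply: ler_wpM2l; first by rewrite mulr_ge0// ltW.
  (* In terms of [u] the claim is [16 u^2 + 8 u^3 <= 1 + 8 u], an equality at [u = 1/2]. *)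
  have -> : v = 1 - u by rewrite /u; ring.
  nra.
rewrite -[X in X - pi / p]mulr1 -mulrBr -/u -/v.
have -> : 2 / p * (pi * u / sin (pi * v)) = 2 * v * (pi * u) / sin (pi * v).
  by rewrite pE /v invrK; ring.
apply: (@le_trans _ _ (2 * v * (pi * u) / sin (pi * v) * (2 * v))).
  by rewrite ler_wpM2l// ?divr_ge0 ?mulr_ge0 ?ltW// /u; lra.
rewrite mulrAC ler_pdivrMr//.
have tv := powR_gt0 v (ltr0n R 2).
rewrite -(ler_pM2r (powR_gt0 u (ltr0n R 2))).
have -> : 9 / 4 * 2 `^ v * sin (pi * v) * 2 `^ u = 9 / 2 * sin (pi * v).
  by rewrite mulrAC -(mulrA _ (2 `^ v)) twoE; lra.
apply: (@le_trans _ _ (2 * v * (pi * u) * (2 * v) * (2 - v))).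
  by rewrite ler_wpM2l// !mulr_ge0 ?ltW// /u; lra.
lra.
Qed.

Lemma C_const_ge s p q : 0 < s < 1 -> 1 <= p -> 1 <= q ->
  q `^ q^-1 <= C_const s p q * (2 `^ p^-1 / 2).
Proof.
move=> /andP[s0 s1] p1 q1; rewrite /C_const.
have c0 := c_const_gt0 p p1; have cle := c_const_le p p1.
set c := c_const p in c0 cle *; set m := Num.max 1 _ `^ _.
have m1 : 1 <= m.
  rewrite -[leLHS](_ : 1 `^ (1 - s) = 1); last by rewrite powR1.
  apply: ge0_ler_powR; rewrite ?nnegrE//; first lra.
    by rewrite le_max ler01.
  by rewrite le_max lexx.
have sq0 : 0 < s * q + 1 by rewrite addr_gt0// mulr_gt0//; lra.
have D2 : (s * q + 1) `^ q^-1 <= 2.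
  have v1 : 0 < q^-1 <= 1 by rewrite invr_gt0 invf_le1//; lra.
  (* After [s <= 1] is used, AM-GM with exponent [1/q] gives [(q + 1)/q + 1 - 1/q = 2]. *)
  apply: (@le_trans _ _ ((q + 1) `^ q^-1)).
    apply: ge0_ler_powR; rewrite ?nnegrE; [lra|exact: ltW|lra|].
    by rewrite lerD2r ler_piMl//; lra.
  apply: le_trans (powR_young _ _ v1 _) _; first lra.
  by rewrite mulrDr mulVf ?mulr1 ?gt_eqF//; lra.
have [q0w sq0w] : 0 <= q /\ 0 <= s * q + 1 by split; lra.
rewrite powRM ?invr_ge0//.
have Q0 : 0 < q `^ q^-1 by rewrite powR_gt0//; lra.
set Q := q `^ q^-1 in Q0 *.
rewrite -[(s * q + 1)^-1]powR_inv1// powRAC powR_inv1 ?powR_ge0//.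
have D0 := powR_gt0 q^-1 sq0.
set D := (s * q + 1) `^ q^-1 in D2 D0 *.
set T := 2 `^ p^-1 in cle *.
(* The constant is regrouped so that every factor multiplying [Q] is at least 1. *)
have -> : 9 / c * (Q / D) * m * (T / 2) = Q * m * ((9 / 4 * T) / c * (2 / D)).
  by field; rewrite !gt_eqF.
rewrite -[leRHS]mulrA; apply: ler_peMr; first exact: ltW.
have h1 : 1 <= 9 / 4 * T / c by rewrite ler_pdivlMr ?mul1r.
have h2 : 1 <= 2 / D by rewrite ler_pdivlMr ?mul1r.
by rewrite mulr_ege1// mulr_ege1.
Qed.

End constants.

(** * Lower bound for the difference seminorm *)

Section lower_bound.
Context {R : realType}.
Local Notation mu := (@lebesgue_measure R).

Lemma Lpnorm_fin_num n (p : R) (f : 'rV[R]_n -> R) : 1 <= p -> lipc f ->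
  Lpnorm p f \is a fin_num.
Proof.
move=> p1 lf; apply: fin_num_poweR; apply: (lebint_fin_num (fun x => `|f x| `^ p)).
  exact: lipc_powR.
by move=> x; exact: powR_ge0.
Qed.

Lemma Lpnorm_fdiff_ge n (Omega : set 'rV[R]_n) (p t : R) xi
    (f : 'rV[R]_n -> R) :
  bounded_set Omega -> open Omega -> 1 <= p -> unit_sphere xi -> lipc f ->
  support_in f Omega -> 0 < t <= width Omega xi ->
  2 `^ p^-1 / 2 * (t / width Omega xi) * fine (Lpnorm p f) <=
  fine (Lpnorm p (fdiff (t *: xi) f)).
Proof.
move=> bO oO p1 uxi lf fO /andP[t0 tw].
have p0 : p != 0 by rewrite gt_eqF//; lra.
set w := width Omega xi in tw *; have w0 : 0 < w by exact: lt_le_trans tw.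
(* [k.+1] is the least number of steps of length [t] that exceeds [w]; since [1 <= w / t], it is at
   most [2 * w / t]. *)
pose k := Num.truncn (w / t).
have kw : w < k.+1%:R * t by rewrite -ltr_pdivrMr// truncnS_gt.
have k2 : k.+1%:R <= 2 * w / t.
  have wt : 1 <= w / t by rewrite ler_pdivlMr// mul1r.
  have : k%:R <= w / t by rewrite truncn_le//; lra.
  by rewrite -natr1 -mulrA; lra.
set F := lebint_Rn (fun x => (`|f x| `^ p)%:E).
set G := lebint_Rn (fun x => (`|fdiff (t *: xi) f x| `^ p)%:E).
have FG : (2%:E * F <= (k.+1%:R `^ p)%:E * G)%E.
  rewrite /F -(lebint_fdiff_disjoint _ _ _ (k.+1%:R *: (t *: xi)))//.
    exact: lebint_fdiff_scale.
  move=> x; have [->|fx] := eqVneq (f x) 0; first by left.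
  right; apply/eqP/negPn/negP => fy.
  have Ox : Omega x by apply: fO; exact: (@subset_closure _ [set x | f x != 0]).
  have Oy : Omega (x + k.+1%:R *: (t *: xi)).
    by apply: fO; exact: (@subset_closure _ [set x | f x != 0]).
  have := lt_width _ _ xi _ _ bO oO uxi Oy Ox.
  by rewrite addrC addKr !dotvZl uxi mulr1 ltNge ltW.
have Ff : F \is a fin_num.
  apply: (lebint_fin_num (fun x => `|f x| `^ p)); first exact: lipc_powR.
  by move=> x; exact: powR_ge0.
have Gf : G \is a fin_num.
  apply: (lebint_fin_num (fun x => `|fdiff (t *: xi) f x| `^ p)).
    exact: lipc_fdiff_powR.
  by move=> x; exact: powR_ge0.
have F0 : 0 <= fine F by apply/fine_ge0/lebint_ge0 => x; rewrite lee_fin powR_ge0.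
have G0 : 0 <= fine G by apply/fine_ge0/lebint_ge0 => x; rewrite lee_fin powR_ge0.
move: FG; rewrite -(fineK Ff) -(fineK Gf) -!EFinM lee_fin => FG.
rewrite /Lpnorm -/F -/G !fine_poweR.
have : (2 * fine F) `^ p^-1 <= (k.+1%:R `^ p * fine G) `^ p^-1.
  apply: ge0_ler_powR => //.
  - by rewrite invr_ge0; lra.
  - by rewrite nnegrE mulr_ge0.
  - by rewrite nnegrE mulr_ge0// powR_ge0.
rewrite !powRM ?powR_ge0// -powRrM mulfV// powRr1// => H.
have {}H : 2 `^ p^-1 * fine F `^ p^-1 <= 2 * w / t * fine G `^ p^-1.
  by apply: le_trans H _; rewrite ler_wpM2r ?powR_ge0.
have -> : 2 `^ p^-1 / 2 * (t / w) * fine F `^ p^-1 =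
    t / (2 * w) * (2 `^ p^-1 * fine F `^ p^-1).
  by field; rewrite gt_eqF.
have -> : fine G `^ p^-1 = t / (2 * w) * (2 * w / t * fine G `^ p^-1).
  by field; rewrite !gt_eqF.
by rewrite ler_wpM2l// divr_ge0//; lra.
Qed.

(** This allows the seminorm to be bounded below without establishing measurability in [t] of the
    difference norms. *)
Lemma le_integral_sub_nonmeas (A B : set R) (f1 f2 : R -> \bar R) :
  A `<=` B -> (forall x, B x -> 0 <= f1 x)%E ->
  (forall x, B x -> f1 x <= f2 x)%E ->
  (\int[mu]_(x in A) f1 x <= \int[mu]_(x in B) f2 x)%E.
Proof.
move=> AB f10 f12; rewrite [leLHS]integral_mkcond [leRHS]integral_mkcond.
apply: le_integral_nonmeas => x.
  by apply: erestrict_ge0 => y /AB; exact: f10.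
rewrite !patchE; case: ifPn => [/set_mem Ax|_].
  by rewrite mem_set; [apply: f12|]; exact: AB.
by case: ifPn => // /set_mem Bx; apply: (le_trans (f10 _ Bx)); exact: f12.
Qed.

Lemma integral_powR (A a e w : R) : 0 < a -> 0 < e < w ->
  (\int[mu]_(t in `[e, w]) (A * t `^ (a - 1))%:E =
   (A * (w `^ a - e `^ a) / a)%:E)%E.
Proof.
move=> a0 /andP[e0 ew].
pose F (t : R) := A / a * t `^ a.
have isF (t : R) : 0 < t -> is_derive t 1 F (A * t `^ (a - 1)).
  move=> t0; rewrite (_ : F = (A / a) \*: (@powR R ^~ a)) //.
  have isP := @is_derive1_powR R a t t0.
  by apply: is_derive_eq; rewrite /GRing.scale/=; field; rewrite gt_eqF.
have cF (t : R) : 0 < t -> {for t, continuous F}.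
  move=> t0; apply: differentiable_continuous; apply/derivable1_diffP.
  by have [] := isF t t0.
have pos (t : R) : t \in `[e, w] -> 0 < t.
  by rewrite in_itv/= => /andP[et _]; exact: lt_le_trans et.
rewrite (@continuous_FTC2 _ _ F)//.
- by rewrite -EFinB /F; congr _%:E; field; rewrite gt_eqF.
- apply: derivable_within_continuous => t /pos t0.
  by apply: derivableM => //; apply: derivable_powR; rewrite in_itv/= andbT.
- split.
  + move=> t te; have [] // := isF t _; apply: pos.
    by move: te; rewrite !in_itv/= => /andP[/ltW-> /ltW->].
  + exact/cvg_at_right_filter/cF.
  + by apply/cvg_at_left_filter/cF; exact: lt_trans ew.
- move=> t te; rewrite derive1E; have [|_ ->//] := isF t.
  by apply: pos; move: te; rewrite !in_itv/= => /andP[/ltW-> /ltW->].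
Qed.

(** The power may be singular at 0, so the integral is truncated to [[e, w]]; it suffices to reach
    every fraction [r < 1] of the bound. *)
Lemma integral_power_lower_bound (A a w : R) (h : R -> \bar R) :
  0 <= A -> 0 < a -> 0 < w ->
  (forall t, 0 < t <= w -> ((A * t `^ (a - 1))%:E <= h t)%E) ->
  ((A * w `^ a / a)%:E <= \int[mu]_(t in `]0%R, w]) h t)%E.
Proof.
move=> A0 a0 w0 hA; have a0w := ltW a0.
apply/lee_mul01Pr; first by rewrite lee_fin !mulr_ge0 ?powR_ge0 ?invr_ge0.
(* This [e] satisfies [e^a = (1 - r) * w^a], so the truncated integral is exactly [r] times the full
   one. *)
move=> r /andP[r0 r1]; pose e := w * (1 - r) `^ a^-1.
have s1 : 0 < 1 - r by lra.
have e0 : 0 < e by rewrite mulr_gt0// powR_gt0.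
have ea : e `^ a = w `^ a * (1 - r).
  rewrite powRM ?powR_ge0 ?ltW// -powRrM mulVf ?gt_eqF// powRr1//; lra.
have ew : e < w.
  rewrite gtr_pMr// -[ltRHS](_ : 1 `^ a^-1 = 1); last by rewrite powR1.
  by rewrite gt0_ltr_powR ?invr_gt0 ?nnegrE//; lra.
have := @integral_powR A a e w a0; rewrite e0 ew => /(_ isT).
rewrite ea (_ : A * _ / a = r * (A * w `^ a / a)); last by ring.
rewrite EFinM => <-; apply: le_integral_sub_nonmeas => t.
- by rewrite /= !in_itv/= => /andP[et ->]; rewrite (lt_le_trans e0 et).
- by rewrite /= in_itv/= => tw; rewrite lee_fin mulr_ge0 ?powR_ge0.
- by rewrite /= in_itv/=; exact: hA.
Qed.

End lower_bound.

(** * Integration of the lower bound in [t] and comparison of the constants *)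

Theorem mainTheorem18 (R : realType) (n : nat) (Omega : set 'rV[R]_n)
  (s p q : R) :
  bounded_set Omega -> open Omega ->
  0 < s < 1 -> 1 <= p -> 1 <= q ->
  forall (xi : 'rV[R]_n) (f : 'rV[R]_n -> R),
    unit_sphere xi -> C1 f -> support_in f Omega ->
    (Lpnorm p f <=
       (C_const s p q * (1 - s) `^ q^-1 * width Omega xi `^ s)%:E *
       poweR (\int[@lebesgue_measure R]_(t in `]0%R, width Omega xi])
                ((t `^ (- (s * q)) / t)%:E * poweR (Lpnorm p (fdiff (t *: xi) f)) q))%E
         q^-1)%E.
Proof.
move=> bO oO s01 p1 q1 xi f uxi C1f fO.
have lf := C1_lipc f Omega bO fO C1f.
have /andP[s0 s1] := s01.
have q0 : 0 < q by lra.
have q0w := ltW q0.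
have C0 : 0 <= C_const s p q.
  have c0 := ltW (c_const_gt0 p p1).
  by rewrite /C_const !mulr_ge0 ?powR_ge0 ?invr_ge0.
(* The zero function is treated apart; otherwise [Omega] has a point and, being open, positive
   width. *)
have [f0|] := pselect (forall x, f x = 0).
  have -> : Lpnorm p f = 0%E.
    rewrite /Lpnorm (_ : (fun x => _) = fun=> 0%E).
      by rewrite lebint0 poweR0r// invr_eq0 gt_eqF//; lra.
    by apply/funext => x; rewrite f0 normr0 powR0// gt_eqF//; lra.
  apply: mule_ge0; last exact: poweR_ge0.
  by rewrite lee_fin (mulr_ge0 (mulr_ge0 C0 _))// powR_ge0.
move=> /existsNP[x0 /eqP fx0].
have Ox0 : Omega x0 by apply: fO; exact: (@subset_closure _ [set x | f x != 0]).
have w0 : 0 < width Omega xi.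
  apply: le_lt_trans (lt_width _ _ xi _ _ bO oO uxi Ox0 Ox0).
  by rewrite subrr /dotv sumr_ge0// => i _; rewrite mxE mul0r.
set w := width Omega xi in w0 *.
have w0w := ltW w0.
pose N := fine (Lpnorm p f).
have N0 : 0 <= N by apply: fine_ge0; exact: poweR_ge0.
rewrite -(fineK (Lpnorm_fin_num _ _ _ p1 lf)) -/N.
(* The norm of the difference with step [t xi] is at least [K * t], so the integrand is at least
   [K^q * t^(a - 1)] with [a = q * (1 - s)]. *)
pose K := 2 `^ p^-1 / 2 * N / w.
have K0 : 0 <= K by rewrite !mulr_ge0 ?powR_ge0 ?invr_ge0//.
pose a := q * (1 - s).
have a0 : 0 < a by rewrite mulr_gt0//; lra.
have a0w := ltW a0.
have : ((K `^ q * w `^ a / a)%:E <= \int[@lebesgue_measure R]_(t in `]0%R, w])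
   ((t `^ (- (s * q)) / t)%:E * poweR (Lpnorm p (fdiff (t *: xi) f)) q))%E.
  apply: integral_power_lower_bound => //; first exact: powR_ge0.
  move=> t /andP[t0 tw]; have t0w := ltW t0.
  have lft : lipc (fdiff (t *: xi) f) by apply: lipcB => //; exact: lipc_translate.
  rewrite -(fineK (Lpnorm_fin_num _ _ _ p1 lft)) poweR_EFin -EFinM lee_fin.
  have tn0 : t != 0 by rewrite gt_eqF.
  have -> : K `^ q * t `^ (a - 1) = t `^ (- (s * q)) / t * (K * t) `^ q.
    rewrite powRM// -[t^-1]powR_inv1// mulrCA -!powRD ?tn0 ?implybT//.
    by congr (_ * _ `^ _); rewrite /a; ring.
  rewrite ler_wpM2l ?divr_ge0 ?powR_ge0//.
  apply: ge0_ler_powR => //.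
  - by rewrite nnegrE mulr_ge0.
  - by rewrite nnegrE; apply: fine_ge0; exact: poweR_ge0.
  have := @Lpnorm_fdiff_ge R n Omega p t xi f bO oO p1 uxi lf fO.
  rewrite -/w t0 tw => /(_ isT); apply: le_trans.
  by rewrite /K -/N le_eqVlt; apply/orP; left; apply/eqP; ring.
set I := integral _ _ _ => lbI.
have S0 : 0 <= K `^ q * w `^ a / a.
  by rewrite !mulr_ge0 ?powR_ge0 ?invr_ge0.
have I0 : (0 <= I)%E by apply: le_trans lbI; rewrite lee_fin.
apply: (@le_trans _ _ ((C_const s p q * (1 - s) `^ q^-1 * w `^ s)%:E *
    poweR (K `^ q * w `^ a / a)%:E q^-1)%E); last first.
  apply: lee_wpmul2l; first by rewrite lee_fin (mulr_ge0 (mulr_ge0 C0 _))// powR_ge0.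
  apply: gt0_ler_poweR; rewrite ?invr_ge0//.
  - by rewrite in_itv/= lee_fin S0 leey.
  - by rewrite in_itv/= I0 leey.
rewrite poweR_EFin -EFinM lee_fin.
(* The root of [a] produces [(1 - s)^(1/q)], which cancels that factor of the statement;
   [w^s * w^(1-s)] will cancel the [1 / w] in [K]. *)
have -> : (K `^ q * w `^ a / a) `^ q^-1 =
    K * w `^ (1 - s) / (q `^ q^-1 * (1 - s) `^ q^-1).
  rewrite powRM ?mulr_ge0 ?powR_ge0 ?invr_ge0//.
  rewrite powRM ?powR_ge0// -!powRrM mulfV ?gt_eqF// powRr1//.
  have -> : a / q = 1 - s by rewrite /a; field; rewrite gt_eqF.
  congr (_ * _).
  rewrite -[a^-1]powR_inv1// powRAC powR_inv1 ?powR_ge0//.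
  by rewrite /a powRM//; lra.
have S1 : 0 < (1 - s) `^ q^-1 by rewrite powR_gt0//; lra.
have Q1 : 0 < q `^ q^-1 by rewrite powR_gt0.
have ws : w `^ s * w `^ (1 - s) = w.
  by rewrite -powRD ?(gt_eqF w0) ?implybT// subrKC powRr1.
have Cge := @C_const_ge R s p q s01 p1 q1.
set Q := q `^ q^-1 in Q1 Cge *; set S := (1 - s) `^ q^-1 in S1 *.
set C := C_const s p q in C0 Cge *.
have -> : C * S * w `^ s * (K * w `^ (1 - s) / (Q * S)) =
    C / Q * K * (w `^ s * w `^ (1 - s)).
  by field; rewrite !gt_eqF.
rewrite ws /K.
have -> : C / Q * (2 `^ p^-1 / 2 * N / w) * w = C * (2 `^ p^-1 / 2) / Q * N.
  by field; rewrite !gt_eqF.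
by rewrite ler_peMl// ler_pdivlMr// mul1r.
Qed.
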